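(* Let $G$ be an embedded graph, let $H$ range over embedded graphs, and let $\sim_{Ci}$ be taken with respect to the canonical checkerboard colourings of medial graphs. Then: 1. $\mathrm{Orb}(G)=\{H\mid H_m\cong G_m\}$ (isomorphism as abstract graphs); 2. $\mathrm{Orb}_{(\delta)}(G)=\{H\mid G_m\sim_{C1}H_m\}=\{H\mid G_m\text{ and }H_m\text{ are equivalent as locally embedded maps}\}$; 3. $\mathrm{Orb}_{(\tau)}(G)=\{H\mid G_m\sim_{C2}H_m\}$; 4. $\mathrm{Orb}_{(\delta\tau)}(G)=\{H\mid G_m\sim_{C3}H_m\}$; 5. $\mathrm{Orb}_{(\delta\tau\delta)}(G)=\{H\mid G_m\sim_{C4}H_m\}$.
   Context: Embedded graphs. An embedded graph is a finite graph (loops and multiple edges allowed) cellularly embedded in a closed, possibly non-orientable, surface. Equivalently, it is a ribbon graph: a surface with boundary that is a union of vertex discs and edge discs, meeting in disjoint line segments, each segment on the boundary of exactly one vertex disc and one edge disc, each edge disc containing exactly two segments. Equivalently, it is an arrow presentation: a set of circles with disjoint labelled arrows on them, each label appearing on exactly two arrows, up to relabelling pairs and reversing both arrows of a given label. Circles correspond to vertex discs; for each label $e$ an edge disc is attached by orienting its boundary, choosing two disjoint boundary arcs directed accordingly, and identifying these with the two $e$-labelled arrows respecting directions. Embedded graphs are considered up to isomorphism (homeomorphism preserving the vertex-edge structure). Locally embedded maps. Choosing an orientation of a neighbourhood of each vertex of an embedded graph gives a cyclic order of the half-edges at each vertex, and so an underlying combinatorial map. Two embedded graphs are equivalent as locally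 embedded maps if the local orientations at their vertices can be chosen so that the resulting combinatorial maps are equal (isomorphic). Twisted duality. For an edge $e$ of $G$ (given as an arrow presentation): $G^{\tau(e)}$ is obtained by reversing exactly one of the two $e$-labelled arrows; $G^{\delta(e)}$ is obtained as follows: if $A,B$ are the two $e$-labelled arrows, add a segment with an $e$-labelled arrow directed from the head of $A$ to the tail of $B$, and a segment with an $e$-labelled arrow directed from the head of $B$ to the tail of $A$, and delete $A$ and $B$ together with the arcs containing them. On each edge $\tau^2=\delta^2=(\tau\delta)^3=1$; operations on different edges commute; words act by $G^{\xi\zeta(e)}=(G^{\zeta(e)})^{\xi(e)}$; so $\mathfrak{G}=\langle\delta,\tau\mid\delta^2,\tau^2,(\tau\delta)^3\rangle\cong S_3$ acts at each edge. $\mathrm{Orb}(G)$ is the set of all embedded graphs obtained from $G$ by applying some element of $\mathfrak{G}$ at each edge; for $\xi\in\mathfrak{G}$, $\mathrm{Orb}_{(\xi)}(G)$ is the set of those obtained by applying some element of the cyclic subgroup $\langle\xi\rangle$ at each edge. Medial graphs. The medial graph $G_m$ of a cellularly embedded graph $G$ is the 4-regular embedded graph in the same surface with a vertex $v_e$ of degree 4 on each edge $e$ of $G$ and edges drawn by following the face boundaries of $G$. An isolated vertex of $G$ gives by convention an isolated face in $G_m$. The canonical checkerboard colouring of $G_m$ colours black the faces containing vertices of $G$ and white the other faces. $C$ moves. Let $F$ be a checkerboard coloured 4-regular embedded graph. At each vertex $v$ there are three pairings of the four half-edges: the black pairing $B_v$ (half-edges adjacent at a common black corner of $v$), the white pairing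 $W_v$ (adjacent at a common white corner), and the crossing pairing $X_v$ (opposite half-edges). Conversely, the abstract graph together with the choice of $B_v,W_v$ at each vertex determines the checkerboard coloured embedded graph (black faces are discs attached along the closed trails given by the pairings $B_v$, white faces along those given by $W_v$). A $Ci$ move at $v$ leaves the abstract graph and the pairings at all other vertices unchanged and changes the pairings at $v$: the $C1$ move (corresponding to $\delta$ on the edge of the black-face graph at $v$) exchanges $B_v$ and $W_v$; the $C2$ move (corresponding to $\tau$) exchanges $W_v$ and $X_v$; the $C3a$ and $C3b$ moves (corresponding to $\tau\delta$ and $\delta\tau$) are the two cyclic permutations of $(W_v,B_v,X_v)$; the $C4$ move (corresponding to $\delta\tau\delta$) exchanges $B_v$ and $X_v$. For checkerboard coloured 4-regular embedded graphs, $F\sim_{Ci}F'$ means that $F$ and $F'$ are related, up to colour preserving isomorphism, by a finite sequence of $Ci$ moves ($C3a$ and $C3b$ moves when $i=3$). *)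

(* Defs.v *)
From mathcomp Require Import all_boot.

Set Implicit Arguments.
Unset Strict Implicit.
Unset Printing Implicit Defensive.

(** * Embedded graphs *)

(* An embedded graph is encoded as a ribbon graph.  Vertex discs and edge discs
   meet in segments, and a flag is an end of such a segment.  From a flag one
   can move along
   - [seg]  : the segment itself (shared by a vertex disc and an edge disc),
   - [side] : the free side of the edge disc,
   - [arc]  : the free arc of the boundary of the vertex disc,
   up to the flag at the other end.  An edge disc contains exactly two
   segments, so [seg] and [side] generate a Klein four-group acting freely.
   Hence segments ([seg]-orbits) are the half-edges, the orbits of
   <seg, arc>, <seg, side>, <side, arc> are the non-isolated vertices, the
   edges, and the faces meeting an edge.  Isolated vertices (each of them on
   its own sphere) have no flag and are counted by [isov].  Connectedness and
   orientability are not required. *)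
Record egraph := EGraph {
  flag : finType;
  seg : flag -> flag;
  side : flag -> flag;
  arc : flag -> flag;
  segK : involutive seg;
  sideK : involutive side;
  arcK : involutive arc;
  seg_side : forall x, seg (side x) = side (seg x);
  seg_neq : forall x, seg x != x;
  side_neq : forall x, side x != x;
  arc_neq : forall x, arc x != x;
  seg_side_neq : forall x, seg (side x) != x;
  isov : nat
}.

Definition egraph_iso (F F' : egraph) : Prop :=
  (exists f : flag F -> flag F',
     [/\ bijective f,
         forall x, f (seg x) = seg (f x),
         forall x, f (side x) = side (f x)
       & forall x, f (arc x) = arc (f x)])
  /\ isov F = isov F'.

Definition is_half (F : egraph) (h : {set flag F}) : bool :=
  [exists x, h == [set x; seg x]].

Definition half (F : egraph) : finType := {h : {set flag F} | is_half h}.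

Fact half_of_proof (F : egraph) (x : flag F) : is_half [set x; seg x].
Proof. by apply/existsP; exists x. Qed.

Definition half_of (F : egraph) (x : flag F) : half F :=
  exist _ [set x; seg x] (half_of_proof x).

Definition same_vertex (F : egraph) : rel (flag F) :=
  connect [rel x y | (y == seg x) || (y == arc x)].

Definition degree (F : egraph) (x : flag F) : nat :=
  #|[set half_of y | y in [set y | same_vertex x y]]|.

(** * Underlying abstract graphs *)

(* The two half-edges of one edge. *)
Definition edge_mates (F : egraph) (h h' : half F) : Prop :=
  exists x : flag F, h = half_of x /\ h' = half_of (side x).

Definition covertex (F : egraph) (h h' : half F) : Prop :=
  exists x y : flag F, [/\ same_vertex x y, h = half_of x & h' = half_of y].

Definition abstract_iso_by (F F' : egraph) (phi : half F -> half F') : Prop :=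
  [/\ bijective phi,
      forall h h', edge_mates h h' <-> edge_mates (phi h) (phi h'),
      forall h h', covertex h h' <-> covertex (phi h) (phi h')
    & isov F = isov F'].

Definition abstract_iso (F F' : egraph) : Prop :=
  exists phi : half F -> half F', abstract_iso_by phi.

(** * Locally embedded maps *)

(* The boundary circle of a vertex disc alternates between segments and free
   arcs, so an orientation of the disc is a choice, for each segment and each
   arc, of its initial end, the terminal end of a segment being the initial
   end of the next arc.  [o x] says that [x] is the initial end of its
   segment. *)
Definition local_orientation (F : egraph) (o : flag F -> bool) : Prop :=
  forall x, o (seg x) = ~~ o x /\ o (arc x) = ~~ o x.

(* [h'] follows [h] in the cyclic order at their vertex. *)
Definition next_half (F : egraph) (o : flag F -> bool) (h h' : half F) : Prop :=
  exists x : flag F, [/\ o x, h = half_of x & h' = half_of (arc (seg x))].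

Definition locally_equiv (F F' : egraph) : Prop :=
  exists (o : flag F -> bool) (o' : flag F' -> bool) (phi : half F -> half F'),
    [/\ local_orientation o /\ local_orientation o',
        bijective phi,
        forall h h', edge_mates h h' <-> edge_mates (phi h) (phi h'),
        forall h h', next_half o h h' <-> next_half o' (phi h) (phi h')
      & isov F = isov F'].

(** * Arrow presentations and twisted duality *)

(* The two arrows with label [e] are (e, true) and (e, false); an arrow end is
   a pair of an arrow and a boolean, [true] for the head and [false] for the
   tail. *)
Definition arrow (L : finType) : finType := (L * bool)%type.
Definition arrow_end (L : finType) : finType := (arrow L * bool)%type.

Definition other_arrow (L : finType) (a : arrow L) : arrow L := (a.1, ~~ a.2).

(* [link] maps an arrow end to the arrow end reached by leaving the arrow and
   following the circle up to the next arrow; [circles] counts the circles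
   without arrows. *)
Record arrow_pres (L : finType) := ArrowPres {
  link : arrow_end L -> arrow_end L;
  linkK : involutive link;
  link_neq : forall z, link z != z;
  circles : nat
}.

Section Ribbon.
Variables (L : finType) (P : arrow_pres L).

Definition pres_seg (z : arrow_end L) : arrow_end L := (z.1, ~~ z.2).

(* An edge disc is glued along its two arrows, both following one orientation
   of its boundary: a free side joins the head of an arrow to the tail of the
   other one. *)
Definition pres_side (z : arrow_end L) : arrow_end L :=
  (other_arrow z.1, ~~ z.2).

Fact pres_segK : involutive pres_seg.
Proof. by case=> [a []]. Qed.
Fact pres_sideK : involutive pres_side.
Proof. by case=> [[l []] []]. Qed.
Fact pres_seg_side z : pres_seg (pres_side z) = pres_side (pres_seg z).
Proof. by []. Qed.
Fact pres_seg_neq z : pres_seg z != z.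
Proof. by case: z => [[l i] []]; rewrite /pres_seg xpair_eqE andbC. Qed.
Fact pres_side_neq z : pres_side z != z.
Proof. by case: z => [[l i] []]; rewrite /pres_side xpair_eqE andbC. Qed.
Fact pres_seg_side_neq z : pres_seg (pres_side z) != z.
Proof.
by case: z => [[l []] s];
   rewrite /pres_seg /pres_side /other_arrow !xpair_eqE /= andbF.
Qed.

Definition ribbon : egraph :=
  EGraph pres_segK pres_sideK (@linkK L P) pres_seg_side pres_seg_neq
    pres_side_neq (@link_neq L P) pres_seg_side_neq (circles P).

End Ribbon.

(* The presentation in which each arrow end [z] is placed at the point where
   the arrow end [p z] of [P] was; the arcs between these points are kept. *)
Section Reposition.
Variables (L : finType) (P : arrow_pres L) (p q : arrow_end L -> arrow_end L).
Hypotheses (pK : cancel p q) (qK : cancel q p).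

Definition reposition_link (z : arrow_end L) : arrow_end L := q (link P (p z)).

Fact reposition_linkK : involutive reposition_link.
Proof. by move=> z; rewrite /reposition_link qK linkK pK. Qed.

Fact reposition_link_neq z : reposition_link z != z.
Proof.
rewrite /reposition_link; apply/eqP => /(congr1 p); rewrite qK => /eqP.
by rewrite (negbTE (link_neq P (p z))).
Qed.

Definition reposition : arrow_pres L :=
  ArrowPres reposition_linkK reposition_link_neq (circles P).

End Reposition.

Definition tau_pos (L : finType) (e : L) (z : arrow_end L) : arrow_end L :=
  if z.1 == (e, true) then (z.1, ~~ z.2) else z.

Fact tau_posK (L : finType) (e : L) : involutive (tau_pos e).
Proof.
by case=> a s; rewrite /tau_pos /=; case E: (a == _); rewrite /= E ?negbK.
Qed.

Definition tau_at (L : finType) (e : L) (P : arrow_pres L) : arrow_pres L :=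
  reposition P (@tau_posK L e) (@tau_posK L e).

(* Each new e-labelled arrow runs from the head of an old one, whose name it
   takes, to the tail of the other old one. *)
Definition delta_pos (L : finType) (e : L) (z : arrow_end L) : arrow_end L :=
  if z.1.1 == e then
    if z.2 then (other_arrow z.1, false) else (z.1, true)
  else z.

Definition delta_pos_inv (L : finType) (e : L) (z : arrow_end L) :
    arrow_end L :=
  if z.1.1 == e then
    if z.2 then (z.1, false) else (other_arrow z.1, true)
  else z.

Fact delta_posK (L : finType) (e : L) : cancel (delta_pos e) (delta_pos_inv e).
Proof.
case=> [[l i] s]; rewrite /delta_pos /=; case: ifP => le; last first.
  by rewrite /delta_pos_inv /= le.
by case: s; rewrite /delta_pos_inv /other_arrow /= le ?negbK.
Qed.

Fact delta_pos_invK (L : finType) (e : L) :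
  cancel (delta_pos_inv e) (delta_pos e).
Proof.
case=> [[l i] s]; rewrite /delta_pos_inv /=; case: ifP => le; last first.
  by rewrite /delta_pos /= le.
by case: s; rewrite /delta_pos /other_arrow /= le ?negbK.
Qed.

Definition delta_at (L : finType) (e : L) (P : arrow_pres L) : arrow_pres L :=
  reposition P (@delta_posK L e) (@delta_pos_invK L e).

Inductive generator := delta | tau.

(* Words represent the elements of the group < delta, tau | delta^2, tau^2,
   (tau delta)^3 >; the rightmost letter acts first. *)
Definition word := seq generator.

Definition gen_at (L : finType) (g : generator) (e : L) :
    arrow_pres L -> arrow_pres L :=
  match g with delta => delta_at e | tau => tau_at e end.

Definition word_at (L : finType) (w : word) (e : L) (P : arrow_pres L) :
    arrow_pres L :=
  foldr (fun g Q => gen_at g e Q) P w.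

Definition twist (L : finType) (w : L -> word) (P : arrow_pres L) :
    arrow_pres L :=
  foldr (fun e Q => word_at (w e) e Q) P (enum L).

Definition orb_with (S : word -> Prop) (G H : egraph) : Prop :=
  exists (L : finType) (P : arrow_pres L) (w : L -> word),
    [/\ egraph_iso (ribbon P) G,
        forall e, S (w e)
      & egraph_iso (ribbon (twist w P)) H].

Definition Orb (G H : egraph) : Prop := orb_with (fun _ => True) G H.

(* The acting group is finite, so nonnegative powers exhaust < xi >. *)
Definition word_power (xi w : word) : Prop :=
  exists n : nat, w = flatten (nseq n xi).

Definition Orb_cyc (xi : word) (G H : egraph) : Prop :=
  orb_with (word_power xi) G H.

(** * Checkerboard coloured 4-regular embedded graphs *)

(* [black x] is the colour of the face whose boundary contains the flag [x]; a
   flag [x] and [seg x] lie on the two sides of the same edge.  Because of the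
   convention on medial graphs of isolated vertices, isolated faces (spherical
   components without vertices) are allowed; [isof true] and [isof false] are
   the numbers of black and of white ones. *)
Record cbgraph := CBGraph {
  cb_emb :> egraph;
  cb_regular : forall x : flag cb_emb, degree x = 4;
  cb_isov : isov cb_emb = 0;
  black : flag cb_emb -> bool;
  black_side : forall x, black (side x) = black x;
  black_arc : forall x, black (arc x) = black x;
  black_seg : forall x, black (seg x) = ~~ black x;
  isof : bool -> nat
}.

Definition nisof (F : cbgraph) : nat := isof F true + isof F false.

Definition cb_abstract_iso (F F' : cbgraph) : Prop :=
  abstract_iso F F' /\ nisof F = nisof F'.

Definition cb_locally_equiv (F F' : cbgraph) : Prop :=
  locally_equiv F F' /\ nisof F = nisof F'.

Definition cb_iso (F F' : cbgraph) : Prop :=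
  (exists f : flag F -> flag F',
     [/\ bijective f,
         forall x, f (seg x) = seg (f x),
         forall x, f (side x) = side (f x),
         forall x, f (arc x) = arc (f x)
       & forall x, black (f x) = black x])
  /\ (forall c, isof F c = isof F' c).

(** * C moves *)

Inductive pairing_kind := Black | White | Crossing.

(* A corner of a vertex is an [arc]-orbit.  Opposite half-edges of a vertex of
   degree 4 are two steps apart along its boundary. *)
Definition paired (F : cbgraph) (k : pairing_kind) (h h' : half F) : Prop :=
  match k with
  | Black => exists x : flag F,
      [/\ black x, h = half_of x & h' = half_of (arc x)]
  | White => exists x : flag F,
      [/\ ~~ black x, h = half_of x & h' = half_of (arc x)]
  | Crossing => exists x : flag F,
      h = half_of x /\ h' = half_of (arc (seg (arc x)))
  end.

Inductive cmove := C1 | C2 | C3a | C3b | C4.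

(* [old_kind m k] is the pairing which becomes the pairing [k] under [m]. *)
Definition old_kind (m : cmove) (k : pairing_kind) : pairing_kind :=
  match m, k with
  | C1, Black => White   | C1, White => Black    | C1, Crossing => Crossing
  | C2, Black => Black   | C2, White => Crossing | C2, Crossing => White
  | C3a, Black => White  | C3a, White => Crossing | C3a, Crossing => Black
  | C3b, Black => Crossing | C3b, White => Black | C3b, Crossing => White
  | C4, Black => Crossing | C4, White => White   | C4, Crossing => Black
  end.

(* [F'] is, up to isomorphism, the result of the move [m] on [F] at the vertex
   of the half-edge [v]. *)
Definition cmove_at (m : cmove) (F : cbgraph) (v : half F) (F' : cbgraph) :
    Prop :=
  exists phi : half F -> half F',
    [/\ abstract_iso_by phi,
        forall c, isof F c = isof F' c,
        forall k h h', covertex v h ->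
          (paired k (phi h) (phi h') <-> paired (old_kind m k) h h')
      & forall k h h', ~ covertex v h ->
          (paired k (phi h) (phi h') <-> paired k h h')].

Inductive csim (S : cmove -> Prop) (F : cbgraph) : cbgraph -> Prop :=
| csim_iso (F' : cbgraph) of cb_iso F F' : csim S F F'
| csim_move (F' F'' : cbgraph) (m : cmove) (v : half F') of
    csim S F F' & S m & cmove_at m v F'' : csim S F F''.

Definition sim_C1 := csim (fun m => m = C1).
Definition sim_C2 := csim (fun m => m = C2).
Definition sim_C3 := csim (fun m => m = C3a \/ m = C3b).
Definition sim_C4 := csim (fun m => m = C4).

(** * Medial graphs *)

(* Half-edges of the medial graph correspond to flags of [G]: the edges of the
   medial graph follow the corners ([arc]-orbits) of [G], and end on the edges
   of [G].  The flag (x, true) is on the side of the half-edge [x] towards the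
   vertex of [G], and (x, false) on the side towards the face of [G].  At the
   medial vertex on an edge of [G], consecutive half-edges are thus separated
   alternately by a segment (black corner) and by a free side (white corner)
   of the edge disc. *)
Section Medial.
Variable G : egraph.

Definition med_flag : finType := (flag G * bool)%type.
Definition med_seg (y : med_flag) : med_flag := (y.1, ~~ y.2).
Definition med_side (y : med_flag) : med_flag := (arc y.1, y.2).
Definition med_arc (y : med_flag) : med_flag :=
  (if y.2 then seg y.1 else side y.1, y.2).

Fact med_segK : involutive med_seg.
Proof. by case=> x []. Qed.
Fact med_sideK : involutive med_side.
Proof. by case=> x b; rewrite /med_side /= arcK. Qed.
Fact med_arcK : involutive med_arc.
Proof. by case=> x []; rewrite /med_arc /= ?segK ?sideK. Qed.
Fact med_seg_side y : med_seg (med_side y) = med_side (med_seg y).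
Proof. by []. Qed.
Fact med_seg_neq y : med_seg y != y.
Proof. by case: y => x []; rewrite xpair_eqE andbC. Qed.
Fact med_side_neq y : med_side y != y.
Proof. by case: y => x b; rewrite xpair_eqE /= negb_and arc_neq. Qed.
Fact med_arc_neq y : med_arc y != y.
Proof. by case: y => x []; rewrite xpair_eqE /= negb_and ?seg_neq ?side_neq. Qed.
Fact med_seg_side_neq y : med_seg (med_side y) != y.
Proof. by case: y => x []; rewrite xpair_eqE andbC. Qed.

Definition medial_emb : egraph :=
  EGraph med_segK med_sideK med_arcK med_seg_side med_seg_neq
    med_side_neq med_arc_neq med_seg_side_neq 0.

Fact half_of_medE (x x' : flag G) (b b' : bool) :
  (@half_of medial_emb (x, b) == @half_of medial_emb (x', b')) = (x == x').
Proof.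
apply/eqP/eqP => [/(congr1 val)/= /setP/(_ (x, b)) | ->].
  rewrite !inE eqxx /= /med_seg /= !xpair_eqE => /esym/orP[] /andP[/eqP-> _] //.
apply: val_inj => /=; apply/setP => y.
by rewrite !inE /med_seg /=; case: b b' => [] [] //=; rewrite orbC.
Qed.

Fact same_vertex_med (y z : flag medial_emb) :
  same_vertex y z =
  [|| z.1 == y.1, z.1 == seg y.1, z.1 == side y.1 | z.1 == seg (side y.1)].
Proof.
pose A (x : flag G) : {set flag G} := [set x; seg x; side x; seg (side x)].
have Aseg x : A (seg x) = A x.
  apply/setP=> t; rewrite !inE segK -seg_side segK.
  by case: (t == x); case: (t == seg x); case: (t == side x);
     case: (t == seg (side x)).
have Aside x : A (side x) = A x.
  apply/setP=> t; rewrite !inE sideK.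
  by case: (t == x); case: (t == seg x); case: (t == side x);
     case: (t == seg (side x)).
have AE t x : (t \in A x) =
    [|| t == x, t == seg x, t == side x | t == seg (side x)].
  by rewrite !inE !orbA.
rewrite -AE; apply/idP/idP => [/connectP[p]|].
  elim: p y => [|w p IHp] y /=; first by move=> _ ->; rewrite !inE eqxx.
  case/andP=> ew pw lz; move: (IHp _ pw lz); case/orP: ew => /eqP-> //=.
  by case: ifP => _; rewrite ?Aseg ?Aside.
have s1 w : same_vertex w (@seg medial_emb w).
  by apply: connect1; rewrite /= eqxx.
have s2 w : same_vertex w (@arc medial_emb w).
  by apply: connect1; rewrite /= eqxx orbT.
have flip x b b' : @same_vertex medial_emb (x, b) (x, b').
  by case: b b' => [] [] //; try exact: connect0; exact: s1.
have tr := @connect_trans _ [rel x y | (y == @seg medial_emb x) || (y == arc x)].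
have toseg x b b' : @same_vertex medial_emb (x, b) (seg x, b').
  by exact: (tr _ _ _ (flip x b true) (tr _ _ _ (s2 (x, true)) (flip _ true b'))).
have toside x b b' : @same_vertex medial_emb (x, b) (side x, b').
  by exact: (tr _ _ _ (flip x b false) (tr _ _ _ (s2 (x, false)) (flip _ false b'))).
case: y z => [x b] [t c] /=; rewrite AE => /or4P[] /eqP->; rewrite ?flip //.
by exact: (tr _ _ _ (toside x b true) (toseg _ true c)).
Qed.

Fact medial_regular (y : flag medial_emb) : degree y = 4.
Proof.
pose A : seq (flag G) := [:: y.1; seg y.1; side y.1; seg (side y.1)].
have neqA : uniq A.
  have n1 (x : flag G) : (x == seg x) = false by rewrite eq_sym (negbTE (seg_neq x)).
  have n2 (x : flag G) : (x == side x) = false by rewrite eq_sym (negbTE (side_neq x)).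
  have n3 (x : flag G) : (x == seg (side x)) = false.
    by rewrite eq_sym (negbTE (seg_side_neq x)).
  have n4 (x : flag G) : (seg x == side x) = false.
    by rewrite (inv_eq (@segK G)) n3.
  by rewrite /= !inE n1 n2 n3 n4 (inj_eq (inv_inj (@segK G))) n2 n1.
pose g (x : flag G) := @half_of medial_emb (x, true).
have g_inj : injective g.
  by move=> x x' /eqP; rewrite half_of_medE => /eqP.
rewrite /degree -[4](size_map g A) -(card_uniqP _) ?map_inj_uniq //.
apply: eq_card => h; apply/imsetP/mapP => [[z]|[x xA ->]].
  rewrite inE same_vertex_med => zA ->; exists z.1; first by rewrite !inE.
  by apply/eqP; case: (z) => t b; rewrite half_of_medE.
by exists (x, true) => //; rewrite inE same_vertex_med; rewrite !inE in xA.
Qed.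

Definition med_black (y : flag medial_emb) : bool := y.2.

Definition med_isof (c : bool) : nat := if c then isov G else 0.

Definition medial : cbgraph :=
  @CBGraph medial_emb medial_regular erefl med_black
    (fun=> erefl) (fun=> erefl) (fun=> erefl) med_isof.

End Medial.

(* Main.v *)
From mathcomp Require Import all_boot.
Require Import Defs.

(** The half-edges of the medial graph [medial G] are the flags of [G]: the
    edges of the medial graph are given by [arc], its vertices are the orbits
    of the Klein four-group generated by [seg] and [side], and the black, white
    and crossing pairings at a vertex are the three involutions [seg], [side]
    and [seg \o side] of that group.  The generators delta and tau change
    nothing but the names of these three involutions at one edge: delta
    exchanges [seg] and [side], tau exchanges [side] and [seg \o side].  So
    [H] is a twisted dual of [G], by words taken in a set [S], exactly when
    some bijection of flags commutes with [arc] and at every flag permutes the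
    three involutions as a word of [S] does; this is [orb_with_twisted].  The
    nontrivial half is that such a bijection comes from an arrow presentation:
    [presentation_exists] gives coordinates to the flags of [G], and
    [twists_at_same_edge] shows that the word found at one flag serves the
    whole edge, because words act by automorphisms of the Klein group.

    Each of the five equivalences then compares this condition on flags with a
    condition on the half-edges of the medial graphs.

    - A C move at a medial vertex permutes the three pairings there in the way
      that some power of the word xi permutes the three involutions.  Twisting
      the edges one after the other is thus a sequence of moves; conversely a
      sequence of moves leaves a bijection of half-edges which permutes the
      pairings at each half-edge as a power of xi ([Orb_cyc_csim]).
    - An isomorphism of abstract medial graphs is a bijection of flags which
      commutes with [arc] and preserves the Klein orbits.  A bijection between
      two orbits of four flags always permutes the three fixed point free
      pairings of the orbit, and every permutation of them is a word in delta
      and tau ([Orb_abstract_iso]).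
    - An orientation of a medial vertex turns around it by applying [side] and
      [seg] alternately.  Reversing the orientation exchanges the two, so the
      cyclic order up to reversal knows [seg] and [side] up to exchange, which
      is the ambiguity created by delta ([Orb_delta_locally_equiv]). *)

Set Implicit Arguments.
Unset Strict Implicit.
Unset Printing Implicit Defensive.

(** * The three involutions of an edge *)

(** Indexed by kinds of pairings because two half-edges of the medial graph,
    seen as flags of [G], are [k]-paired when [edge_inv k] exchanges them. *)
Definition edge_inv (G : egraph) (k : pairing_kind) (x : flag G) : flag G :=
  match k with
  | Black => seg x
  | White => side x
  | Crossing => seg (side x)
  end.

(** The multiplication of the Klein four-group, whose unit is [None]. *)
Definition kind_comp (i j : pairing_kind) : option pairing_kind :=
  match i, j with
  | Black, White | White, Black => Some Crossing
  | Black, Crossing | Crossing, Black => Some White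
  | White, Crossing | Crossing, White => Some Black
  | _, _ => None
  end.

Lemma edge_inv_comp (G : egraph) i j (x : flag G) :
  edge_inv i (edge_inv j x) = oapp (fun k => edge_inv k x) x (kind_comp i j).
Proof. by case: i j => [] [] /=; rewrite ?(seg_side, sideK, segK). Qed.

Lemma edge_invK (G : egraph) k : involutive (@edge_inv G k).
Proof. by move=> x; rewrite edge_inv_comp; case: k. Qed.

Lemma edge_inv_neq (G : egraph) k (x : flag G) : edge_inv k x <> x.
Proof.
by case: k => /eqP; apply/negP; rewrite ?seg_neq ?side_neq ?seg_side_neq.
Qed.

Lemma edge_inv_kind_inj (G : egraph) (x : flag G) :
  injective (fun k => edge_inv k x).
Proof.
move=> i j /(congr1 (edge_inv i)); rewrite edge_invK edge_inv_comp.
by case: i j => [] [] //= /esym => [/(@edge_inv_neq G Crossing)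
  | /(@edge_inv_neq G White) | /(@edge_inv_neq G Crossing)
  | /(@edge_inv_neq G Black) | /(@edge_inv_neq G White)
  | /(@edge_inv_neq G Black)].
Qed.

Definition same_edge (G : egraph) (x y : flag G) : Prop :=
  y = x \/ exists k, y = edge_inv k x.

Lemma same_edge_sym (G : egraph) (x y : flag G) :
  same_edge x y -> same_edge y x.
Proof.
case=> [->|[k ->]]; first by left.
by right; exists k; rewrite edge_invK.
Qed.

(** * Words acting on the kinds of pairings *)

(** [kind_gen g k] is the kind of the involution which becomes the one of kind
    [k] after [g], in agreement with [old_kind]. *)
Definition kind_gen (g : generator) (k : pairing_kind) : pairing_kind :=
  match g, k with
  | delta, Black => White | delta, White => Black | delta, Crossing => Crossing
  | tau, Black => Black | tau, White => Crossing | tau, Crossing => White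
  end.

(** The rightmost letter of a word is applied first to a graph.  As kinds are
    pulled back from the new graph to the old one, the leftmost letter is the
    first to be applied to a kind. *)
Definition kind_word (w : word) (k : pairing_kind) : pairing_kind :=
  foldl (fun k g => kind_gen g k) k w.

Lemma kind_word_cat w w' k :
  kind_word (w ++ w') k = kind_word w' (kind_word w k).
Proof. exact: foldl_cat. Qed.

Lemma kind_word_surj w i : exists j, kind_word w j = i.
Proof.
elim: w i => [|g w IHw] i; first by exists i.
have [j <-] := IHw i; exists (kind_gen g j); congr (kind_word w).
by case: g j => [] [].
Qed.

(** Any permutation of the three nontrivial elements is an automorphism of the
    Klein four-group. *)
Lemma kind_comp_word w i j :
  kind_comp (kind_word w i) (kind_word w j) =
  omap (kind_word w) (kind_comp i j).
Proof.
elim: w i j => [|g w IHw] i j /=; first by case: (kind_comp i j).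
by rewrite IHw; case: g i j => [] [] [].
Qed.

(** The two transpositions given by delta and tau generate all the permutations
    of the three kinds. *)
Lemma permutation_word (p : pairing_kind -> pairing_kind) :
  injective p -> exists w, kind_word w =1 p.
Proof.
move=> p_inj.
have BW : p Black <> p White by move/p_inj.
have BX : p Black <> p Crossing by move/p_inj.
have WX : p White <> p Crossing by move/p_inj.
move: BW BX WX.
case EB: (p Black); case EW: (p White); case EX: (p Crossing) => // _ _ _.
- by exists [::]; case.
- by exists [:: tau]; case.
- by exists [:: delta]; case.
- by exists [:: tau; delta]; case.
- by exists [:: delta; tau]; case.
- by exists [:: delta; tau; delta]; case.
Qed.

(** * Twists as bijections of flags *)

Definition twists_at (G H : egraph) (f : flag G -> flag H) (w : word)
    (x : flag G) : Prop :=
  forall k, f (edge_inv (kind_word w k) x) = edge_inv k (f x).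

(** Any flag of the edge is obtained from [x] by one involution, and words
    respect the composition of involutions, so the relation found at [x] is
    transported to the whole edge. *)
Lemma twists_at_same_edge (G H : egraph) (f : flag G -> flag H) w x y :
  same_edge x y -> twists_at f w x -> twists_at f w y.
Proof.
case=> [->//|[j ->]] fx k; have [i <-] := kind_word_surj w j.
rewrite fx !edge_inv_comp kind_comp_word.
by case: (kind_comp k i) => //= l; rewrite fx.
Qed.

Definition twisting (S : word -> Prop) (G H : egraph) (f : flag G -> flag H) :
    Prop :=
  [/\ bijective f, forall x, f (arc x) = arc (f x)
    & forall x, exists2 w, S w & twists_at f w x].

Definition twisted (S : word -> Prop) (G H : egraph) : Prop :=
  (exists f : flag G -> flag H, twisting S f) /\ isov G = isov H.

Lemma twisting_same_edge S (G H : egraph) (f : flag G -> flag H) x y :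
  twisting S f -> same_edge x y <-> same_edge (f x) (f y).
Proof.
case=> /bij_inj f_inj _ /(_ x)[w _ fx]; split=> [[->|[j ->]]|[|[k]]].
- by left.
- by right; have [i <-] := kind_word_surj w j; exists i.
- by move/f_inj->; left.
- by rewrite -fx => /f_inj->; right; exists (kind_word w k).
Qed.

(** The three other flags of the edge of [x] go to the three other flags of the
    edge of [f x].  This is a permutation of the kinds, hence the action of a
    word. *)
Lemma twisting_of_same_edge (G H : egraph) (f : flag G -> flag H) :
  bijective f -> (forall x, f (arc x) = arc (f x)) ->
  (forall x y, same_edge x y <-> same_edge (f x) (f y)) ->
  twisting (fun _ => True) f.
Proof.
move=> f_bij f_arc f_edge; split=> // x; have [g fK gK] := f_bij.
have mate k : exists j, f (edge_inv j x) = edge_inv k (f x).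
  have /f_edge : same_edge (f x) (f (g (edge_inv k (f x)))).
    by right; exists k; rewrite gK.
  case=> [/(congr1 f)|[j Ej]]; first by rewrite gK => /edge_inv_neq.
  by exists j; rewrite -Ej gK.
have [[b fb] [v fv] [c fc]] := And3 (mate Black) (mate White) (mate Crossing).
pose p k := match k with Black => b | White => v | Crossing => c end.
have fp k : f (edge_inv (p k) x) = edge_inv k (f x) by case: k.
have [|w wp] := @permutation_word p.
  by move=> i j Eij; apply: (@edge_inv_kind_inj _ (f x)); rewrite /= -!fp Eij.
by exists w => // k; rewrite wp.
Qed.

(** * Twisted duals of arrow presentations *)

(** The outcome of a sequence of twists on a presentation: the arrow ends have
    been moved within each label, and [p e] tells which old involution each new
    one is at the edge [e].  Unlike in [twisting], the labels are tracked, since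
    a twist at one label must be the identity at the others. *)
Definition placed (L : finType) (p : L -> pairing_kind -> pairing_kind)
    (P Q : arrow_pres L) : Prop :=
  (exists f : flag (ribbon P) -> flag (ribbon Q),
     [/\ bijective f,
         forall z, f (arc z) = arc (f z),
         forall z : flag (ribbon P), (f z).1.1 = z.1.1
       & forall (z : flag (ribbon P)) k,
           f (edge_inv (p z.1.1 k) z) = edge_inv k (f z)])
  /\ circles P = circles Q.

Lemma placed_id (L : finType) (p : L -> pairing_kind -> pairing_kind) P :
  (forall e k, p e k = k) -> placed p P P.
Proof.
move=> p_id; split=> //; exists id; split=> // [|z k]; last by rewrite p_id.
by exists id.
Qed.

Lemma placed_trans (L : finType) (p p' q : L -> pairing_kind -> pairing_kind)
    (P Q R : arrow_pres L) :
  (forall e k, q e k = p e (p' e k)) ->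
  placed p P Q -> placed p' Q R -> placed q P R.
Proof.
move=> qE [[f [f_bij f_arc f_lab fE]] cPQ] [[g [g_bij g_arc g_lab gE]] cQR].
split; last by rewrite cPQ.
exists (g \o f); split=> [|z|z|z k] /=.
- exact: bij_comp.
- by rewrite f_arc g_arc.
- by rewrite g_lab.
- by rewrite qE fE -(f_lab z) gE.
Qed.

(** The bijection is the inverse of the map that tells where the new arrow ends
    stand among the old ones. *)
Lemma placed_gen (L : finType) g (e : L) (P : arrow_pres L) :
  placed (fun e' k => if e' == e then kind_gen g k else k) P (gen_at g e P).
Proof.
split; last by case: g.
case: g.
- exists (delta_pos_inv e); split=> [|z|z|[[l a] s] k].
  + exists (delta_pos e); [exact: delta_pos_invK | exact: delta_posK].
  + by rewrite /= /reposition_link delta_pos_invK.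
  + by rewrite /delta_pos_inv; case: ifP => // _; case: z.2.
  + by case: (eqVneq l e) => [-> | /negbTE le]; case: k a s => [] [] [];
      rewrite /= /pres_seg /pres_side /other_arrow /delta_pos_inv /= ?eqxx ?le.
- exists (tau_pos e); split=> [|z|z|[[l a] s] k].
  + by exists (tau_pos e); exact: tau_posK.
  + by rewrite /= /reposition_link tau_posK.
  + by rewrite /tau_pos; case: ifP.
  + by case: (eqVneq l e) => [-> | /negbTE le]; case: k a s => [] [] [];
      rewrite /= /pres_seg /pres_side /other_arrow /tau_pos /= ?xpair_eqE /=
              ?eqxx ?le.
Qed.

Lemma placed_word (L : finType) w (e : L) (P : arrow_pres L) :
  placed (fun e' k => if e' == e then kind_word w k else k) P (word_at w e P).
Proof.
elim: w => [|g w IHw]; first by apply: placed_id => e' k; rewrite if_same.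
by apply: placed_trans IHw (placed_gen _ _ _) => e' k; case: ifP.
Qed.

Lemma placed_twist (L : finType) (w : L -> word) (P : arrow_pres L) :
  placed (fun e => kind_word (w e)) P (twist w P).
Proof.
(* Twisting along a list of distinct labels acts at the labels already met. *)
pose p (s : seq L) e k := if e \in s then kind_word (w e) k else k.
suff: placed (p (enum L)) P (twist w P).
  move=> placed_enum.
  apply: placed_trans placed_enum (placed_id _ (p := fun=> id) _) => //.
  by move=> e k; rewrite /p mem_enum.
rewrite /twist; elim: (enum L) (enum_uniq L) => [|e s IHs] /= => [_|].
  exact: placed_id.
case/andP=> es /IHs/placed_trans; apply; last exact: placed_word.
move=> e' k; rewrite /p inE; case: eqP => [->|] //=.
by rewrite (negbTE es).
Qed.

(** * Arrow presentations of embedded graphs *)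

Lemma inj_surj_bij (T T' : finType) (f : T -> T') :
  injective f -> (forall y, exists x, f x = y) -> bijective f.
Proof.
move=> f_inj f_surj.
have [g gK] := fin_all_exists f_surj.
by exists g => // x; apply: f_inj.
Qed.

Section Presentation.
Variable G : egraph.

Definition edge_set (x : flag G) : {set flag G} :=
  [set y | [|| y == x, y == seg x, y == side x | y == seg (side x)]].

Lemma edge_setP x y : reflect (same_edge x y) (y \in edge_set x).
Proof.
rewrite inE; apply: (iffP or4P) => [[] /eqP->|[->|[[] ->]]].
- by left.
- by right; exists Black.
- by right; exists White.
- by right; exists Crossing.
- exact: Or41.
- exact: Or42.
- exact: Or43.
- exact: Or44.
Qed.

Lemma edge_set_inv k x : edge_set (edge_inv k x) = edge_set x.
Proof.
apply/setP=> y; apply/edge_setP/edge_setP=> [[->|[j ->]]|[->|[j ->]]].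
- by right; exists k.
- rewrite edge_inv_comp; case: (kind_comp j k) => [i|]; last by left.
  by right; exists i.
- by right; exists k; rewrite edge_invK.
- rewrite -[x in edge_inv j x](edge_invK k) (edge_inv_comp j k).
  by case: (kind_comp j k) => [i|]; [right; exists i | left].
Qed.

(** A representative of the edge, the same for all its flags, since it depends
    on [x] through its orbit. *)
Definition edge_root (x : flag G) : flag G := odflt x [pick y in edge_set x].

Lemma edge_root_same x : same_edge (edge_root x) x.
Proof.
apply: same_edge_sym; apply/edge_setP; rewrite /edge_root.
by case: pickP => //= _; apply/edge_setP; left.
Qed.

Lemma edge_root_inv k x : edge_root (edge_inv k x) = edge_root x.
Proof.
rewrite /edge_root edge_set_inv; case: pickP => // /(_ x) /edge_setP[].
by left.
Qed.

Lemma edge_root_idem x : edge_root (edge_root x) == edge_root x.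
Proof.
apply/eqP; case: (edge_root_same x) => [{2}->|[k Ex]] //.
by rewrite {2}Ex edge_root_inv.
Qed.

Definition edge_label : finType := {x : flag G | edge_root x == x}.

(** The coordinates of a ribbon presentation: the representative of an edge is
    the head of its first arrow, [seg] goes to the other end of an arrow, and
    [side] to the opposite end of the other arrow. *)
Definition flag_at (z : arrow_end edge_label) : flag G :=
  let x := val z.1.1 in
  match z.1.2, z.2 with
  | true, true => x
  | true, false => seg x
  | false, false => side x
  | false, true => seg (side x)
  end.

Lemma flag_at_seg z : flag_at (pres_seg z) = seg (flag_at z).
Proof. by case: z => [[e []] []]; rewrite /flag_at /= ?segK. Qed.

Lemma flag_at_side z : flag_at (pres_side z) = side (flag_at z).
Proof.
by case: z => [[e []] []]; rewrite /flag_at /= ?seg_side ?sideK.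
Qed.

Lemma edge_root_flag_at z : edge_root (flag_at z) = val z.1.1.
Proof.
rewrite -[RHS](eqP (valP z.1.1)).
by case: z => [[e []] []]; rewrite /flag_at //=;
   [exact: (edge_root_inv Black) | exact: (edge_root_inv Crossing)
   | exact: (edge_root_inv White)].
Qed.

Lemma flag_at_bij : bijective flag_at.
Proof.
apply: inj_surj_bij => [z z' Ez|x].
  have El : z.1.1 = z'.1.1 by apply: val_inj; rewrite -!edge_root_flag_at Ez.
  case: z z' El Ez => [[e a] s] [[e' a'] s'] /= <-{e'}.
  have neq k := @edge_inv_neq G k (val e).
  have inj := @edge_inv_kind_inj G (val e).
  case: a s a' s' => [] [] [] []; rewrite /flag_at //=;
    by [move/(neq Black) | move/(neq White) | move/(neq Crossing)
       | move/esym/(neq Black) | move/esym/(neq White)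
       | move/esym/(neq Crossing)
       | move/(inj Black White) | move/(inj Black Crossing)
       | move/(inj White Black) | move/(inj White Crossing)
       | move/(inj Crossing White) | move/(inj Crossing Black)].
pose e : edge_label := exist _ (edge_root x) (edge_root_idem x).
case: (edge_root_same x) => [Ex|[[] Ex]].
- by exists (e, true, true).
- by exists (e, true, false).
- by exists (e, false, false).
- by exists (e, false, true).
Qed.

(** Every embedded graph is the ribbon graph of an arrow presentation: the arcs
    are transported through the coordinates of the flags. *)
Lemma presentation_exists :
  exists (L : finType) (P : arrow_pres L) (f : flag (ribbon P) -> flag G),
    [/\ bijective f, forall z, f (arc z) = arc (f z),
        forall k z, f (edge_inv k z) = edge_inv k (f z)
      & circles P = isov G].
Proof.
have [g gK Kg] := flag_at_bij.
pose l z := g (arc (flag_at z)).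
have lK : involutive l by move=> z; rewrite /l Kg arcK gK.
have l_neq z : l z != z.
  apply/eqP=> /(congr1 flag_at); rewrite Kg => /eqP.
  by rewrite (negbTE (arc_neq _)).
exists edge_label, (ArrowPres lK l_neq (isov G)), flag_at; split=> //.
- by exists g.
- by move=> z; rewrite /= Kg.
- by case=> z; [exact: flag_at_seg | exact: flag_at_side
               | rewrite /= flag_at_seg flag_at_side].
Qed.

End Presentation.

(** * Orbits are the classes of twisted graphs *)

Lemma egraph_iso_of_edge_inv (G H : egraph) (f : flag G -> flag H) :
  bijective f -> (forall x, f (arc x) = arc (f x)) ->
  (forall k x, f (edge_inv k x) = edge_inv k (f x)) -> isov G = isov H ->
  egraph_iso G H.
Proof.
move=> f_bij f_arc f_inv GH; split=> //; exists f; split=> // x.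
  exact: (f_inv Black).
exact: (f_inv White).
Qed.

Lemma egraph_iso_inv (G H : egraph) : egraph_iso G H ->
  isov G = isov H /\
  exists f : flag G -> flag H,
    [/\ bijective f, forall x, f (arc x) = arc (f x)
      & forall k x, f (edge_inv k x) = edge_inv k (f x)].
Proof.
case=> [[f [f_bij f_seg f_side f_arc]] GH]; split=> //.
by exists f; split=> // -[] x /=; rewrite ?f_seg ?f_side.
Qed.

Lemma egraph_iso_sym (G H : egraph) : egraph_iso G H -> egraph_iso H G.
Proof.
case/egraph_iso_inv=> GH [f [[g fK gK] f_arc f_inv]].
apply: (@egraph_iso_of_edge_inv _ _ g) => // [|x|k x].
- by exists f.
- by rewrite -{1}(gK x) -f_arc fK.
- by rewrite -{1}(gK x) -f_inv fK.
Qed.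

(** From right to left, the words are read at the heads of the first arrows of
    a presentation of [G].  Twisting by them renames the involutions exactly as
    the given bijection does, so that both bijections together form an
    isomorphism from the twisted presentation to [H]. *)
Lemma orb_with_twisted S (G H : egraph) : orb_with S G H <-> twisted S G H.
Proof.
split=> [[L [P [w [PG wS PH]]]] | [[f [f_bij f_arc f_tw]] GH]].
  have [GP [a [a_bij a_arc a_inv]]] := egraph_iso_inv (egraph_iso_sym PG).
  have [QH [b [b_bij b_arc b_inv]]] := egraph_iso_inv PH.
  have [[g [g_bij g_arc _ g_tw]] PQ] := placed_twist w P.
  split; last by rewrite GP -QH.
  exists (b \o (g \o a)); split=> [|x|x].
  - by do 2!apply: bij_comp => //.
  - by rewrite /= a_arc g_arc b_arc.
  - by exists (w (a x).1.1) => // k; rewrite /= a_inv g_tw b_inv.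
have [L [P [c [c_bij c_arc c_inv PG]]]] := presentation_exists G.
have [w wS wP] := fin_all_exists2 (fun e : L => f_tw (c (e, true, true))).
(* The word read at one flag of an edge is valid at its three other flags. *)
have fc_tw (z : flag (ribbon P)) : twists_at f (w z.1.1) (c z).
  apply: twists_at_same_edge (wP z.1.1).
  case: z => [[e []] []] /=; first by left.
  - by right; exists Black; rewrite -c_inv.
  - by right; exists Crossing; rewrite -c_inv.
  - by right; exists White; rewrite -c_inv.
have [[g [[h gK hK] g_arc _ g_tw]] PQ] := placed_twist w P.
exists L, P, w; split=> [|e|].
- exact: (egraph_iso_of_edge_inv c_bij c_arc c_inv PG).
- exact: wS.
apply: (@egraph_iso_of_edge_inv _ _ (f \o (c \o h))) => [|y|k y|].
- by do 2!apply: bij_comp => //; exists g.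
- by rewrite -[arc ((f \o _) y)]f_arc -c_arc -{1}(hK y) -g_arc /comp gK.
- by rewrite -{1}(hK y) -g_tw /comp gK c_inv fc_tw.
- by rewrite -GH -PG.
Qed.

(** * Half-edges *)

Lemma half_of_surj (F : egraph) (h : half F) : exists x, half_of x = h.
Proof.
case: h => h hP; have [x /eqP Ex] := existsP hP.
by exists x; apply: val_inj.
Qed.

Lemma half_of_seg (F : egraph) (x : flag F) : half_of (seg x) = half_of x.
Proof. by apply: val_inj; rewrite /= segK setUC. Qed.

Lemma half_of_eq (F : egraph) (x y : flag F) :
  half_of x = half_of y -> y = x \/ y = seg x.
Proof.
move/(congr1 val)/setP/(_ y); rewrite !inE eqxx /=.
by case/orP=> /eqP->; [left | right].
Qed.

(** A bijection of flags and its inverse both act on half-edges.  Having the two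
    actions at hand makes each converse implication an instance of the direct
    one. *)
Lemma half_map (F F' : egraph) (f : flag F -> flag F') (g : flag F' -> flag F) :
  cancel f g -> cancel g f -> (forall x, f (seg x) = seg (f x)) ->
  exists (phi : half F -> half F') (psi : half F' -> half F),
    [/\ cancel phi psi, cancel psi phi,
        forall x, phi (half_of x) = half_of (f x)
      & forall y, psi (half_of y) = half_of (g y)].
Proof.
move=> fK gK f_seg.
have g_seg y : g (seg y) = seg (g y) by rewrite -{1}(gK y) -f_seg fK.
have [r rK] := fin_all_exists (@half_of_surj F).
have [r' r'K] := fin_all_exists (@half_of_surj F').
have phiE x : half_of (f (r (half_of x))) = half_of (f x).
  by case: (half_of_eq (rK (half_of x))) => {2}->; rewrite ?f_seg ?half_of_seg.
have psiE y : half_of (g (r' (half_of y))) = half_of (g y).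
  by case: (half_of_eq (r'K (half_of y))) => {2}->; rewrite ?g_seg ?half_of_seg.
exists (fun h => half_of (f (r h))), (fun h => half_of (g (r' h))).
split=> // h; first by rewrite psiE fK rK.
by rewrite phiE gK r'K.
Qed.

Lemma same_vertex_map (F F' : egraph) (f : flag F -> flag F') x y :
  (forall x, f (seg x) = seg (f x)) -> (forall x, f (arc x) = arc (f x)) ->
  same_vertex x y -> same_vertex (f x) (f y).
Proof.
move=> f_seg f_arc /connectP[p]; elim: p x => [|z p IHp] x /=.
  by move=> _ ->; exact: connect0.
case/andP=> xz /IHp{}IHp /IHp; apply: connect_trans; apply: connect1.
by case/orP: xz => /eqP-> /=; rewrite ?f_seg ?f_arc eqxx ?orbT.
Qed.

(** What an isomorphism of coloured graphs leaves of itself at the level of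
    half-edges, where the moves are defined. *)
Lemma cb_iso_halves (F F' : cbgraph) : cb_iso F F' ->
  (forall c, isof F c = isof F' c) /\
  exists phi : half F -> half F',
    abstract_iso_by phi /\
    forall k h h', paired k (phi h) (phi h') <-> paired k h h'.
Proof.
case=> [[f [[g fK gK] f_seg f_side f_arc f_black]] FF']; split=> //.
have g_seg y : g (seg y) = seg (g y) by rewrite -{1}(gK y) -f_seg fK.
have g_side y : g (side y) = side (g y) by rewrite -{1}(gK y) -f_side fK.
have g_arc y : g (arc y) = arc (g y) by rewrite -{1}(gK y) -f_arc fK.
have g_black y : black (g y) = black y by rewrite -{2}(gK y) f_black.
have [phi [psi [phiK psiK phiE psiE]]] := half_map fK gK f_seg.
exists phi; split.
  split; first by exists psi.
  - move=> h h'; split=> [[x [-> ->]]|[y [Eh Eh']]].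
      by exists (f x); rewrite !phiE f_side.
    by exists (g y); rewrite -(phiK h) -(phiK h') Eh Eh' !psiE g_side.
  - move=> h h'; split=> [[x [y [xy -> ->]]]|[x [y [xy Eh Eh']]]].
      by exists (f x), (f y); rewrite !phiE same_vertex_map.
    exists (g x), (g y).
    by rewrite -(phiK h) -(phiK h') Eh Eh' !psiE same_vertex_map.
  - by rewrite !cb_isov.
move=> k h h'; split.
  case: k => [[y [yb Eh Eh']]|[y [yb Eh Eh']]|[y [Eh Eh']]];
    by exists (g y); rewrite -(phiK h) -(phiK h') Eh Eh' !psiE
                             ?g_black ?g_arc ?g_seg ?g_arc.
by case: k => [[x [xb -> ->]]|[x [xb -> ->]]|[x [-> ->]]];
  exists (f x); rewrite !phiE ?f_black ?f_arc ?f_seg ?f_arc.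
Qed.

(** * Medial graphs in terms of flags *)

Section MedialHalf.
Variable G : egraph.

(** The flags [(x, true)] and [(x, false)] are the two sides of the half-edge of
    the medial graph that corresponds to the flag [x]. *)
Definition med_half (x : flag G) : half (medial G) :=
  @half_of (medial_emb G) (x, true).

Lemma med_halfE (x : flag G) b : @half_of (medial_emb G) (x, b) = med_half x.
Proof. by apply/eqP; rewrite half_of_medE. Qed.

Lemma med_half_inj : injective med_half.
Proof. by move=> x y /eqP; rewrite half_of_medE => /eqP. Qed.

Lemma med_half_bij : bijective med_half.
Proof.
apply: inj_surj_bij => [|h]; first exact: med_half_inj.
have [[x b] <-] := half_of_surj h.
by exists x; rewrite -(med_halfE x b).
Qed.

Lemma edge_mates_med (x y : flag G) :
  edge_mates (med_half x) (med_half y) <-> y = arc x.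
Proof.
split=> [[[z b] []]|->]; last by exists (x, true).
by rewrite /= /med_side /= !med_halfE => /med_half_inj-> /med_half_inj.
Qed.

Lemma covertex_med (x y : flag G) :
  covertex (med_half x) (med_half y) <-> same_edge x y.
Proof.
split=> [[[z b] [[t c] []]]|].
  rewrite same_vertex_med /= !med_halfE => zt /med_half_inj-> /med_half_inj->.
  by apply/edge_setP; rewrite inE.
move/edge_setP; rewrite inE => xy.
by exists (x, true), (y, true); rewrite same_vertex_med.
Qed.

Lemma paired_med k (x y : flag G) :
  paired k (med_half x) (med_half y) <-> y = edge_inv k x.
Proof.
case: k; split=> [[[z b] /= []]|->].
- by case: b => //= _; rewrite /med_arc /= !med_halfE
    => /med_half_inj-> /med_half_inj.
- by exists (x, true).
- by case: b => //= _; rewrite /med_arc /= !med_halfE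
    => /med_half_inj-> /med_half_inj.
- by exists (x, false); rewrite /= /med_arc /= !med_halfE.
- by case: b; rewrite /med_arc /med_seg /= !med_halfE
    => /med_half_inj-> /med_half_inj->; rewrite ?seg_side.
- by exists (x, false); rewrite /= /med_arc /med_seg /= !med_halfE.
Qed.

End MedialHalf.

Lemma med_lift (G H : egraph) (f : flag G -> flag H) :
  exists phi : half (medial G) -> half (medial H),
    forall x, phi (med_half x) = med_half (f x).
Proof.
have [u uK _] := med_half_bij G.
by exists (fun h => med_half (f (u h))) => x; rewrite uK.
Qed.

Lemma med_unlift (G H : egraph) (phi : half (medial G) -> half (medial H)) :
  exists f : flag G -> flag H, forall x, phi (med_half x) = med_half (f x).
Proof.
have [u _ uK] := med_half_bij H.
by exists (fun x => u (phi (med_half x))) => x; rewrite uK.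
Qed.

(** Under the correspondence [med_half] between flags and half-edges, each
    property of a bijection of flags is a property of the bijection of
    half-edges. *)
Section Lift.
Variables (G H : egraph) (phi : half (medial G) -> half (medial H)).
Variable f : flag G -> flag H.
Hypothesis phiE : forall x, phi (med_half x) = med_half (f x).

Lemma lift_bij : bijective phi <-> bijective f.
Proof.
have [u uK Ku] := med_half_bij G; have [v vK Kv] := med_half_bij H.
split=> [[psi phiK psiK]|[g fK gK]].
  exists (fun y => u (psi (med_half y))) => x; first by rewrite -phiE phiK uK.
  by apply: med_half_inj; rewrite -phiE Ku psiK.
exists (fun h => med_half (g (v h))) => h.
  by rewrite -(Ku h) phiE vK fK.
by rewrite phiE gK Kv.
Qed.

Lemma lift_edge_mates : bijective f ->
  (forall h h', edge_mates h h' <-> edge_mates (phi h) (phi h')) <->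
  (forall x, f (arc x) = arc (f x)).
Proof.
move/bij_inj=> f_inj; have [u _ Ku] := med_half_bij G.
split=> [f_mates x|f_arc h h'].
  by apply/edge_mates_med; rewrite -!phiE; apply/f_mates/edge_mates_med.
rewrite -(Ku h) -(Ku h') !phiE; split=> /edge_mates_med.
  by move=> ->; apply/edge_mates_med.
by rewrite -f_arc => /f_inj->; apply/edge_mates_med.
Qed.

Lemma lift_abstract_iso S : twisting S f -> abstract_iso_by phi.
Proof.
move=> f_tw; have [f_bij f_arc _] := f_tw.
split; [exact/lift_bij | exact/lift_edge_mates | | by []].
have [u _ Ku] := med_half_bij G.
move=> h h'; rewrite -(Ku h) -(Ku h') !phiE; split=> /covertex_med.
  by move/(twisting_same_edge _ _ f_tw) => ?; apply/covertex_med.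
by move/(twisting_same_edge _ _ f_tw) => ?; apply/covertex_med.
Qed.

Lemma lift_paired w x : bijective f ->
  (forall k h', paired k (phi (med_half x)) (phi h') <->
                paired (kind_word w k) (med_half x) h') <->
  twists_at f w x.
Proof.
move/bij_inj=> f_inj; have [u _ Ku] := med_half_bij G.
split=> [phi_pair k|f_tw k h'].
  by apply/paired_med; rewrite -!phiE; apply/phi_pair/paired_med.
rewrite -(Ku h') !phiE; split=> /paired_med.
  by rewrite -f_tw => /f_inj->; apply/paired_med.
by move=> ->; apply/paired_med.
Qed.

End Lift.

(** * Sequences of moves *)

(** Being at a common vertex is decidable because there are finitely many
    flags. *)
Lemma covertex_em (F : egraph) (h h' : half F) :
  covertex h h' \/ ~ covertex h h'.
Proof.
case: (boolP [exists x, exists y,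
  [&& same_vertex x y, h == half_of x & h' == half_of y]]).
  by case/existsP=> x /existsP[y /and3P[xy /eqP-> /eqP->]]; left; exists x, y.
move=> no; right=> -[x [y [xy Eh Eh']]]; case/negP: no.
by apply/existsP; exists x; apply/existsP; exists y; rewrite xy Eh Eh' !eqxx.
Qed.

Lemma word_power_cat xi w w' :
  word_power xi w -> word_power xi w' -> word_power xi (w ++ w').
Proof.
by move=> [n ->] [n' ->]; exists (n + n'); rewrite nseqD flatten_cat.
Qed.

(** The definition of [csim] allows an isomorphism at the start of a sequence
    only.  At the end, it can be absorbed in the last move. *)
Lemma csim_iso_right (S : cmove -> Prop) (F F' F'' : cbgraph) :
  csim S F F' -> cb_iso F' F'' -> csim S F F''.
Proof.
move=> FF'; case: FF' => {F'} [F' [[f [f_bij f_seg f_side f_arc f_black]] fi]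
    | F1 F' m v FF1 Sm
      [phi [[phi_bij phi_mates phi_vx phi_iso] phi_f phi_v phi_nv]]].
  case=> [[g [g_bij g_seg g_side g_arc g_black]] gi]; apply: csim_iso.
  split=> [|c]; last by rewrite fi.
  exists (g \o f); split=> [|x|x|x|x] /=; first exact: bij_comp.
  - by rewrite f_seg.
  - by rewrite f_side.
  - by rewrite f_arc.
  - by rewrite g_black.
case/cb_iso_halves=> gi [g [[g_bij g_mates g_vx g_iso] g_pair]].
apply: (csim_move (v := v) FF1 Sm).
exists (g \o phi); split=> [|c|k h h' vh|k h h' vh].
- split=> [|h h'|h h'|]; first exact: bij_comp.
  + exact: iff_trans (phi_mates h h') (g_mates _ _).
  + exact: iff_trans (phi_vx h h') (g_vx _ _).
  + by rewrite phi_iso.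
- by rewrite phi_f.
- exact: iff_trans (g_pair _ _ _) (phi_v k h h' vh).
- exact: iff_trans (g_pair _ _ _) (phi_nv k h h' vh).
Qed.

Lemma medial_iso (G H : egraph) :
  egraph_iso G H -> cb_iso (medial G) (medial H).
Proof.
case=> [[f [[g fK gK] f_seg f_side f_arc]] GH]; split; last by case.
exists (fun y : flag (medial G) => (f y.1, y.2)); split=> // [|[x b]|[x []]] /=.
- by exists (fun y : flag (medial H) => (g y.1, y.2)) => -[x b] /=;
    rewrite ?fK ?gK.
- by rewrite /med_side /= f_arc.
- by rewrite /med_arc /= f_seg.
- by rewrite /med_arc /= f_side.
Qed.

(** The coloured graphs met along the sequence need not be medial graphs, so
    the invariant speaks of half-edges and pairings only.  The word may vary
    with the half-edge; [twists_at_same_edge] makes it uniform along a vertex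
    of a medial graph. *)
Lemma csim_pairings xi (S : cmove -> Prop) (F F' : cbgraph) :
  (forall m, S m -> exists2 w, word_power xi w & kind_word w =1 old_kind m) ->
  csim S F F' ->
  (forall c, isof F c = isof F' c) /\
  exists phi : half F -> half F',
    [/\ bijective phi,
        forall h h', edge_mates h h' <-> edge_mates (phi h) (phi h')
      & forall h, exists2 w, word_power xi w &
          forall k h', paired k (phi h) (phi h') <->
                       paired (kind_word w k) h h'].
Proof.
move=> S_xi; elim=> {F'} [F' /cb_iso_halves[fi [phi [[? ? _ _] phi_pair]]]
  | F' F'' m v _ [fi [phi [phi_bij phi_mates phi_pair]]] /S_xi[w xi_w wE]].
  by split=> //; exists phi; split=> // h; exists [::]; first by exists 0.
case=> psi [[psi_bij psi_mates _ _] gi psi_v psi_nv].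
split=> [c|]; first by rewrite fi.
exists (psi \o phi); split=> [|h h'|h]; first exact: bij_comp.
  exact: iff_trans (phi_mates h h') (psi_mates _ _).
have [u xi_u uE] := phi_pair h.
(* The move adds a power of [xi] at its own vertex and nothing elsewhere. *)
have [vh|vh] := covertex_em v (phi h); last first.
  by exists u => // k h'; apply: iff_trans (uE k h'); apply: psi_nv.
exists (w ++ u) => [|k h']; first exact: word_power_cat.
rewrite kind_word_cat wE; apply: iff_trans (uE _ h'); exact: psi_v.
Qed.

(** The half-edges at the vertex of the move are the flags of the edge labelled
    [e], which are the ones where the twist renames the involutions. *)
Lemma cmove_word (L : finType) xi m (e : L) (P : arrow_pres L) :
  kind_word xi =1 old_kind m ->
  cmove_at m (med_half (G := ribbon P) (e, true, true))
    (medial (ribbon (word_at xi e P))).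
Proof.
move=> xiE.
have [[f [f_bij f_arc _ f_tw]] PQ] := placed_word xi e P.
have f_at (z : flag (ribbon P)) :
    twists_at f (if z.1.1 == e then xi else [::]) z.
  by move=> k; rewrite -f_tw; case: ifP.
have f_twg : twisting (fun=> True) f.
  by split=> // z; exists (if z.1.1 == e then xi else [::]).
have [phi phiE] := med_lift f; have [u _ Ku] := med_half_bij (ribbon P).
have vE (z : flag (ribbon P)) :
    covertex (med_half (G := ribbon P) (e, true, true)) (med_half z) <->
    z.1.1 = e.
  split=> [/covertex_med[->|[[] ->]]|] //.
  case: z => [[l []] []] /= ->; apply/covertex_med.
  - by left.
  - by right; exists Black.
  - by right; exists Crossing.
  - by right; exists White.
exists phi; split=> [|[] //|k h h'|k h h'].
- exact: lift_abstract_iso phiE _ f_twg.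
- rewrite -(Ku h) => /vE he; rewrite -xiE.
  by have := f_at (u h); rewrite he eqxx => /(lift_paired phiE _ _ f_bij).
- rewrite -(Ku h) => /vE/eqP/negbTE he.
  by have := f_at (u h); rewrite he => /(lift_paired phiE _ _ f_bij).
Qed.

Lemma csim_twist S xi m (G : cbgraph) (L : finType) (w : L -> word)
    (P : arrow_pres L) :
  S m -> kind_word xi =1 old_kind m -> (forall e, word_power xi (w e)) ->
  csim S G (medial (ribbon P)) -> csim S G (medial (ribbon (twist w P))).
Proof.
move=> Sm xiE w_xi GP; rewrite /twist; elim: (enum L) => //= e s IHs.
have [n ->] := w_xi e; elim: n => //= n IHn.
rewrite /word_at foldr_cat; apply: csim_move IHn Sm _.
exact: cmove_word.
Qed.

(** One move [m] must realise [xi] itself, to follow a twist by moves; every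
    move in [S] must act as a power of [xi], to follow moves by twists. *)
Theorem Orb_cyc_csim xi (S : cmove -> Prop) m (G H : egraph) :
  S m -> kind_word xi =1 old_kind m ->
  (forall m, S m -> exists2 w, word_power xi w & kind_word w =1 old_kind m) ->
  Orb_cyc xi G H <-> csim S (medial G) (medial H).
Proof.
move=> Sm xiE S_xi; split=> [[L [P [w [PG w_xi PH]]]]|].
  apply: csim_iso_right (medial_iso PH); apply: csim_twist Sm xiE w_xi _.
  exact/csim_iso/medial_iso/egraph_iso_sym.
case/(csim_pairings S_xi)=> fi [phi [phi_bij phi_mates phi_pair]].
apply/orb_with_twisted; split; last exact: (fi true).
have [f phiE] := med_unlift phi; exists f.
have f_bij : bijective f by apply/(lift_bij phiE).
split=> // [|x]; first exact/(lift_edge_mates phiE).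
have [w xi_w wE] := phi_pair (med_half x).
by exists w => //; apply/(lift_paired phiE).
Qed.

(** * Isomorphism of the underlying abstract graphs *)

Lemma abstract_iso_sym (F F' : egraph) : abstract_iso F F' -> abstract_iso F' F.
Proof.
case=> phi [[psi phiK psiK] mates vx iso]; exists psi; split=> //.
- by exists phi.
- by move=> h h'; rewrite -{1}(psiK h) -{1}(psiK h'); apply: iff_sym.
- by move=> h h'; rewrite -{1}(psiK h) -{1}(psiK h'); apply: iff_sym.
Qed.

(** Any word may be applied, so all that remains of a twist is that the flags of
    an edge stay together. *)
Theorem Orb_abstract_iso (G H : egraph) :
  Orb G H <-> cb_abstract_iso (medial H) (medial G).
Proof.
apply: iff_trans (orb_with_twisted _ G H) _.
rewrite /cb_abstract_iso /nisof /= !addn0.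
split=> [[[f f_tw] GH]|[/abstract_iso_sym[phi [phi_bij mates vx _]] HG]].
  split=> //; apply: abstract_iso_sym; have [phi phiE] := med_lift f.
  by exists phi; apply: lift_abstract_iso f_tw.
split=> //; have [f phiE] := med_unlift phi; exists f.
have f_bij : bijective f by apply/(lift_bij phiE).
apply: twisting_of_same_edge => // [|x y]; first exact/(lift_edge_mates phiE).
split=> [/covertex_med/vx|]; first by rewrite !phiE => /covertex_med.
by move/covertex_med; rewrite -!phiE => /vx/covertex_med.
Qed.

(** * Local equivalence *)

Lemma kind_word_delta_power w : word_power [:: delta] w ->
  kind_word w =1 id \/ kind_word w =1 kind_gen delta.
Proof.
case=> n ->; elim: n => [|n IHn]; first by left.
by case: IHn => IHn; [right | left] => k; rewrite /= IHn; case: k.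
Qed.

(** The local orientations of the medial graph in terms of flags: a medial
    vertex is crossed from one half-edge to the next through [seg] and [side]
    alternately, and [v x] tells which of the two follows [x]. *)
Definition edge_oriented (G : egraph) (v : flag G -> bool) : Prop :=
  forall x, v (seg x) = ~~ v x /\ v (side x) = ~~ v x.

(** In an arrow presentation, being the head of an arrow is such an
    orientation, since [seg] and [side] both exchange heads and tails. *)
Lemma edge_oriented_exists (G : egraph) :
  exists v : flag G -> bool, edge_oriented v.
Proof.
have [L [P [f [[g fK gK] _ f_inv _]]]] := presentation_exists G.
have g_inv k x : g (edge_inv k x) = edge_inv k (g x).
  by rewrite -{1}(gK x) -f_inv fK.
exists (fun x => (g x).2) => x.
by rewrite (g_inv Black) (g_inv White).
Qed.

(** The next half-edge in the cyclic order at a medial vertex, and the previous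
    one. *)
Definition turn (G : egraph) (v : flag G -> bool) (x : flag G) : flag G :=
  if v x then side x else seg x.

Definition turn_back (G : egraph) (v : flag G -> bool) (x : flag G) : flag G :=
  if v x then seg x else side x.

Section Turn.
Variables (G : egraph) (v : flag G -> bool).
Hypothesis v_or : edge_oriented v.

Lemma turnK : cancel (turn v) (turn_back v).
Proof.
by move=> x; rewrite /turn_back /turn; have [vS vs] := v_or x;
   case vx: (v x); rewrite ?vS ?vs vx /= ?segK ?sideK.
Qed.

Lemma turn_backK : cancel (turn_back v) (turn v).
Proof.
by move=> x; rewrite /turn_back /turn; have [vS vs] := v_or x;
   case vx: (v x); rewrite ?vS ?vs vx /= ?segK ?sideK.
Qed.

Lemma turn_turn x : turn v (turn v x) = seg (side x).
Proof.
by rewrite /turn; have [vS vs] := v_or x;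
   case vx: (v x); rewrite ?vS ?vs vx /= ?seg_side.
Qed.

Lemma local_orientation_med :
  local_orientation (fun y : flag (medial G) => v y.1 (+) ~~ y.2).
Proof.
case=> x b /=; rewrite /med_arc addbN; split=> //=.
by case: b; have [vS vs] := v_or x; rewrite ?vS ?vs addNb.
Qed.

End Turn.

Lemma edge_oriented_med (G : egraph) (o : flag (medial G) -> bool) :
  local_orientation o -> edge_oriented (fun x => o (x, true)).
Proof.
move=> o_or x; have [_ oS] := o_or (x, true); split=> //.
have [o1 _] := o_or (x, true); have [_ o2] := o_or (x, false).
have [o3 _] := o_or (side x, true).
by apply: negb_inj; rewrite -[LHS]o3 [LHS]o2; congr (~~ _).
Qed.

Lemma next_half_med (G : egraph) (o : flag (medial G) -> bool) x y :
  local_orientation o ->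
  next_half o (med_half x) (med_half y) <->
  y = turn (fun x => o (x, true)) x.
Proof.
rewrite /turn => o_or.
have oN z : o (z, false) = ~~ o (z, true) by have [] := o_or (z, true).
split=> [[[z b] []]|->].
  rewrite /= /med_arc /med_seg /= !med_halfE => oz.
  move=> /med_half_inj-> /med_half_inj->.
  by case: b oz => [->|] //; rewrite oN => /negbTE->.
case: ifP => ox; first by exists (x, true); rewrite /= /med_arc /= !med_halfE.
by exists (x, false); rewrite oN ox /= /med_arc /= !med_halfE.
Qed.

Lemma lift_next_half (G H : egraph) (phi : half (medial G) -> half (medial H))
    (f : flag G -> flag H) (o : flag (medial G) -> bool)
    (o' : flag (medial H) -> bool) :
  (forall x, phi (med_half x) = med_half (f x)) -> bijective f ->
  local_orientation o -> local_orientation o' ->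
  (forall h h', next_half o h h' <-> next_half o' (phi h) (phi h')) <->
  (forall x, f (turn (fun x => o (x, true)) x) =
             turn (fun y => o' (y, true)) (f x)).
Proof.
move=> phiE /bij_inj f_inj o_or o'_or; have [u _ Ku] := med_half_bij G.
split=> [f_next x|f_turn h h'].
  by apply/next_half_med; rewrite // -!phiE; apply/f_next/next_half_med.
rewrite -(Ku h) -(Ku h') !phiE; split=> /next_half_med.
  by move=> ->//; apply/next_half_med.
by rewrite -f_turn => /(_ o'_or)/f_inj->; apply/next_half_med.
Qed.

(** From left to right, the orientation of [G] is carried to [H] and reversed on
    the edges where [seg] and [side] have been exchanged, so that both still
    turn in the same way.  From right to left, a bijection compatible with the
    turns preserves [seg] and [side] where the orientations agree on a flag, and
    exchanges them where they do not; two turns make [seg \o side] in both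
    cases. *)
Theorem Orb_delta_locally_equiv (G H : egraph) :
  Orb_cyc [:: delta] G H <-> cb_locally_equiv (medial G) (medial H).
Proof.
apply: iff_trans (orb_with_twisted _ G H) _.
rewrite /cb_locally_equiv /nisof /= !addn0; split.
  case=> [[f [f_bij f_arc f_tw]] GH]; split=> //.
  have [v v_or] := edge_oriented_exists G.
  have [phi phiE] := med_lift f; have [g fK gK] := f_bij.
  pose keep x := f (seg x) == seg (f x).
  (* Whether delta was applied is the same for all the flags of an edge. *)
  have keepP x : exists b, forall y, same_edge x y ->
      [/\ keep y = b, f (seg y) = (if b then seg (f y) else side (f y))
        & f (side y) = (if b then side (f y) else seg (f y))].
    have [w /kind_word_delta_power w_delta wx] := f_tw x.
    case: w_delta => wE; [exists true | exists false] => y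
      /twists_at_same_edge/(_ wx) wy; have := wy Black; have := wy White;
      rewrite !wE /= /keep => -> ->; rewrite ?eqxx //; split=> //.
    by apply/eqP=> /(@edge_inv_kind_inj _ (f y) White Black).
  pose v' y := v (g y) (+) ~~ keep (g y).
  have v'_or : edge_oriented v'.
    move=> y; rewrite -(gK y); have [vS vs] := v_or (g y).
    have [b bP] := keepP (g y).
    have [|kx fS fs] := bP (g y); first by left.
    have [|kS _ _] := bP (seg (g y)); first by right; exists Black.
    have [|ks _ _] := bP (side (g y)); first by right; exists White.
    by case: b kx fS fs kS ks {bP} => kx fS fs kS ks; rewrite -?fS -?fs
       /v' !fK ?vS ?vs kx ?kS ?ks ?addNb.
  exists (fun y : flag (medial G) => v y.1 (+) ~~ y.2).
  exists (fun y : flag (medial H) => v' y.1 (+) ~~ y.2), phi; split=> //.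
  - by split; apply: local_orientation_med.
  - exact/(lift_bij phiE).
  - exact/(lift_edge_mates phiE).
  apply/(lift_next_half phiE) => //; try exact: local_orientation_med.
  move=> x; rewrite /turn /= /v' fK !addbF.
  have [b bP] := keepP x; have [|-> fS fs] := bP x; first by left.
  by rewrite (fun_if f) fS fs; case: (b) (v x) => [] [].
case=> [[o [o' [phi [[o_or o'_or] phi_bij mates next _]]]] GH]; split=> //.
have [f phiE] := med_unlift phi; exists f.
have f_bij : bijective f by apply/(lift_bij phiE).
split=> //; first exact/(lift_edge_mates phiE).
have /(lift_next_half phiE)f_turn := next.
have v_or := edge_oriented_med o_or; have v'_or := edge_oriented_med o'_or.
set v := fun x : flag G => _ in v_or f_turn.
set v' := fun x : flag H => _ in v'_or f_turn.
have {}f_turn x : f (turn v x) = turn v' (f x) by apply: f_turn.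
have f_back x : f (turn_back v x) = turn_back v' (f x).
  by rewrite -{2}(turn_backK v_or x) f_turn (turnK v'_or).
have f_opp x : f (seg (side x)) = seg (side (f x)).
  by rewrite -(turn_turn v_or) !f_turn (turn_turn v'_or).
move=> x; have := f_turn x; have := f_back x; rewrite /turn /turn_back.
exists (if v x == v' (f x) then [::] else [:: delta]).
  by case: ifP; [exists 0 | exists 1].
by case=> /=; move: (f_turn x) (f_back x); rewrite /turn /turn_back;
   case: (v x) (v' (f x)) => [] [] /=.
Qed.

Theorem theorem4p33 (G : egraph) :
  [/\ forall H : egraph, Orb G H <-> cb_abstract_iso (medial H) (medial G),
      (forall H : egraph,
         Orb_cyc [:: delta] G H <-> sim_C1 (medial G) (medial H))
      /\ (forall H : egraph,
         Orb_cyc [:: delta] G H <-> cb_locally_equiv (medial G) (medial H)),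
      forall H : egraph,
        Orb_cyc [:: tau] G H <-> sim_C2 (medial G) (medial H),
      forall H : egraph,
        Orb_cyc [:: delta; tau] G H <-> sim_C3 (medial G) (medial H)
    & forall H : egraph,
        Orb_cyc [:: delta; tau; delta] G H <-> sim_C4 (medial G) (medial H)].
Proof.
split=> [H||H|H|H].
- exact: Orb_abstract_iso.
- split=> H; last exact: Orb_delta_locally_equiv.
  apply: (@Orb_cyc_csim _ _ C1) => // m ->.
  by exists [:: delta]; [exists 1 | case].
- apply: (@Orb_cyc_csim _ _ C2) => // m ->.
  by exists [:: tau]; [exists 1 | case].
- apply: (@Orb_cyc_csim _ _ C3b) => [||m [] ->]; [by right | by case | |].
    (* C3a is the inverse, hence the square, of C3b. *)
    by exists [:: delta; tau; delta; tau]; [exists 2 | case].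
  by exists [:: delta; tau]; [exists 1 | case].
- apply: (@Orb_cyc_csim _ _ C4) => // [|m ->]; first by case.
  by exists [:: delta; tau; delta]; [exists 1 | case].
Qed.
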